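(* Let $\beta,\eta>0$, $\omega,E_F\in\mathbb R$ and $\zeta=(\beta,\eta,\omega,E_F)$. Let $k\in\mathbb N$ and denote by $\alpha_{k,\beta,E_F}$ the parameter of the Bernstein ellipse through the Fermi-Dirac poles $E_F\pm\frac{(2k+1)\pi i}{\beta}$. There exists a function $R_{k,\beta,E_F}(E_1,E_2)$ analytic on the biellipse $E(\alpha_{k,\beta,E_F})^2\supset E(\alpha_{0,\beta,E_F})^2$ such that $$F_\zeta(E_1,E_2)=\frac{1}{E_1-E_2+\omega+i\eta}\left(\sum_{z\in Z_k}\frac1\beta\,\frac{1}{(E_1-z)(E_2-z)}+R_{k,\beta,E_F}(E_1,E_2)\right),$$ where $$Z_k=\bigl\{E_F+\tfrac{\ell\pi i}{\beta}\ :\ \ell\in\{-2k+1,-2k+3,\ldots,2k-3,2k-1\}\bigr\}.$$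
   Context: $f_\beta(E)=(1+e^{\beta E})^{-1}$ and $F_\zeta(E_1,E_2)=\dfrac{f_\beta(E_1-E_F)-f_\beta(E_2-E_F)}{(E_1-E_2)(E_1-E_2+\omega+i\eta)}$, extended by analytic continuation across $E_1=E_2$. $Z_k$ is a subset of the set $\{E_F+\frac{i\pi\ell}{\beta}:\ell\text{ odd}\}$ of poles of $E\mapsto f_\beta(E-E_F)$. The Bernstein ellipse with parameter $\alpha$ is $E(\alpha)=\{\cosh\tilde\alpha\cos\theta+i\sinh\tilde\alpha\sin\theta:\tilde\alpha\in[0,\alpha),\ \theta\in[0,2\pi)\}$; the parameter of the ellipse through a point $x$ is the $\alpha\ge0$ with $x\in\partial E(\alpha)$. A function of two complex variables is analytic if it is analytic in each variable separately. *)

(* Defs.v *)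
From Stdlib Require Import Reals ZArith List.
From Coquelicot Require Import Coquelicot.
Open Scope C_scope.

Definition Cexp (z : C) : C := (exp (Re z) * cos (Im z), exp (Re z) * sin (Im z))%R.

Definition fermi (beta : R) (E : C) : C := / (1 + Cexp (beta * E)).

Definition F_off_diag (beta eta omega EF : R) (E1 E2 : C) : C :=
  (fermi beta (E1 - EF) - fermi beta (E2 - EF))
  / ((E1 - E2) * (E1 - E2 + omega + Ci * eta)).

(* The singularity of [fun E => F_off_diag E E2] at [E = E2] is removable, so
   the value of the analytic continuation there is the limit. *)
Definition F (beta eta omega EF : R) (E1 E2 : C) : C :=
  if Ceq_dec E1 E2 then
    iota (fun l : C_CompleteNormedModule =>
      filterlim (fun E : C => F_off_diag beta eta omega EF E E2)
                (locally' E2) (locally l))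
  else F_off_diag beta eta omega EF E1 E2.

(* This is the open region, not the curve; it is empty for [alpha = 0]. *)
Definition bernstein (alpha : R) (z : C) : Prop :=
  exists a theta : R,
    (0 <= a < alpha)%R /\ (0 <= theta < 2 * PI)%R /\
    z = RtoC (cosh a * cos theta) + Ci * RtoC (sinh a * sin theta).

Definition closure (S : C -> Prop) (z : C) : Prop :=
  forall eps : posreal, exists w : C, (Cmod (w - z) < eps)%R /\ S w.

Definition boundary (S : C -> Prop) (z : C) : Prop :=
  closure S z /\ closure (fun w => ~ S w) z.

Definition is_bernstein_param (x : C) (alpha : R) : Prop :=
  (0 <= alpha)%R /\ boundary (bernstein alpha) x.

Definition fermi_pole (beta EF : R) (l : Z) : C := EF + IZR l * PI * Ci / beta.

(* [iota] picks the unique real satisfying the predicate. The two conjuncts say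
   that the ellipse passes through the poles E_F + (2k+1) pi i / beta and
   E_F - (2k+1) pi i / beta. *)
Definition alpha_fermi (k : nat) (beta EF : R) : R :=
  iota (fun alpha : R_CompleteNormedModule =>
    is_bernstein_param (fermi_pole beta EF (2 * Z.of_nat k + 1)) alpha /\
    is_bernstein_param (fermi_pole beta EF (- (2 * Z.of_nat k + 1))) alpha).

(* The 2k values l = -2k+1, -2k+3, ..., 2k-1 are distinct, so this duplicate-free
   list (empty for k = 0) represents the set Z_k. *)
Definition Zk (k : nat) (beta EF : R) : list C :=
  map (fun j => fermi_pole beta EF (- 2 * Z.of_nat k + 1 + 2 * Z.of_nat j))
      (seq 0 (2 * k)).

Definition Csum (s : list C) (g : C -> C) : C := fold_right Cplus 0 (map g s).

Definition analytic_at (f : C -> C) (z0 : C) : Prop :=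
  exists (r : posreal) (a : nat -> C),
    forall z : C, (Cmod (z - z0) < r)%R ->
      @is_pseries C_AbsRing C_NormedModule a (z - z0) (f z).

Definition analytic2_on (U : C -> Prop) (f : C -> C -> C) : Prop :=
  forall z1 z2 : C, U z1 -> U z2 ->
    analytic_at (fun z => f z z2) z1 /\ analytic_at (fun z => f z1 z) z2.

(* Main.v *)
Require Import Defs.
From Stdlib Require Import Reals ZArith List Lra Lia.
From Coquelicot Require Import Coquelicot.
Open Scope C_scope.

(* All poles of the Fermi function [f] are simple with residue [- / beta], and
   the poles in the open ellipse are exactly those in [Zk].  Hence
   [f = - / beta * \sum_(z in Zk) / (E - z) + h] with [h] analytic on the ellipse.
   Dividing [f E1 - f E2] by [E1 - E2] turns each pole term into
   [/ beta * / ((E1 - z) * (E2 - z))], and the remainder is the divided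
   difference of [h], which is analytic in each variable. *)

(** * Complex series *)

(** [analytic_at] means a local power series, so every closure property is proved on coefficients.
    The reciprocal is the delicate one: its coefficients have to be built and shown to grow at most
    geometrically. Convergence is read off real and imaginary parts, where the real theorems apply.
    Two more obstacles shape the proof. The ellipse is given by a parametrization and its parameter
    by a boundary condition under [iota]; both become comparisons of focal sums and, for the poles,
    which share the real part [EF], comparisons of imaginary parts. The diagonal value of [F] is a
    limit under [iota]; it is computed by exhibiting an analytic function that agrees with the
    off-diagonal formula on a punctured disc. The residues come from periodicity: near each pole [p]
    the Fermi function is [/ (1 - Cexp u)] with [u = beta * (z - p)], so a single expansion at
    [u = 0] settles all poles. *)

Definition is_Cseries (a : nat -> C) (l : C) : Prop :=
  is_series (fun n => Re (a n)) (Re l) /\ is_series (fun n => Im (a n)) (Im l).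

Lemma Re_sum_n (a : nat -> C) (n : nat) :
  Re (sum_n a n) = sum_n (fun k => Re (a k)) n.
Proof.
  induction n as [|n IH].
  - now rewrite !sum_O.
  - now rewrite !sum_Sn, <- IH.
Qed.

Lemma Im_sum_n (a : nat -> C) (n : nat) :
  Im (sum_n a n) = sum_n (fun k => Im (a k)) n.
Proof.
  induction n as [|n IH].
  - now rewrite !sum_O.
  - now rewrite !sum_Sn, <- IH.
Qed.

Lemma is_series_C (a : nat -> C) (l : C) :
  @is_series C_AbsRing C_NormedModule a l <-> is_Cseries a l.
Proof.
  unfold is_Cseries, is_series; split.
  - intros H; split; apply filterlim_locally; intros eps;
      generalize (proj1 (filterlim_locally _ _) H eps);
      apply filter_imp; intros n [Hr Hi];
      [rewrite <- Re_sum_n | rewrite <- Im_sum_n]; assumption.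
  - intros [Hr Hi]; apply filterlim_locally; intros eps.
    generalize (filter_and _ _ (proj1 (filterlim_locally _ _) Hr eps)
                  (proj1 (filterlim_locally _ _) Hi eps)).
    apply filter_imp; intros n [H1 H2].
    rewrite <- Re_sum_n in H1; rewrite <- Im_sum_n in H2.
    split; assumption.
Qed.

Lemma is_Cseries_ext (a b : nat -> C) (l : C) :
  (forall n, a n = b n) -> is_Cseries a l -> is_Cseries b l.
Proof.
  intros H [H1 H2]; split;
    [apply is_series_ext with (2 := H1)|apply is_series_ext with (2 := H2)];
    intros n; now rewrite H.
Qed.

Lemma pow_n_Cpow (z : C) (n : nat) : @pow_n C_AbsRing z n = z ^ n.
Proof.
  induction n as [|n IH]; [reflexivity|].
  rewrite Cpow_S, <- IH; reflexivity.
Qed.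

Lemma is_pseries_C (a : nat -> C) (z l : C) :
  @is_pseries C_AbsRing C_NormedModule a z l <->
  is_Cseries (fun n => a n * z ^ n) l.
Proof.
  unfold is_pseries; rewrite is_series_C.
  assert (E : forall n, a n * z ^ n =
                @scal C_AbsRing C_NormedModule (@pow_n C_AbsRing z n) (a n))
    by (intros n; rewrite <- pow_n_Cpow; apply Cmult_comm).
  split; apply is_Cseries_ext; auto.
Qed.

Lemma is_Cseries_unique (a : nat -> C) (l1 l2 : C) :
  is_Cseries a l1 -> is_Cseries a l2 -> l1 = l2.
Proof.
  intros [H1 H2] [H3 H4].
  apply is_series_unique in H1, H2, H3, H4.
  destruct l1, l2; simpl in *; congruence.
Qed.

Lemma is_Cseries_plus (a b : nat -> C) (la lb : C) :
  is_Cseries a la -> is_Cseries b lb ->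
  is_Cseries (fun n => a n + b n) (la + lb).
Proof.
  rewrite <- !is_series_C; apply (@is_series_plus C_AbsRing C_NormedModule).
Qed.

Lemma is_Cseries_scal (c : C) (a : nat -> C) (l : C) :
  is_Cseries a l -> is_Cseries (fun n => c * a n) (c * l).
Proof.
  rewrite <- !is_series_C; apply (@is_series_scal C_AbsRing C_NormedModule).
Qed.

Lemma im_le_Cmod (c : C) : (Rabs (Im c) <= Cmod c)%R.
Proof.
  eapply Rle_trans; [apply Rmax_r|apply Rmax_Cmod].
Qed.

Lemma ex_series_Re_Im (a : nat -> C) :
  ex_series (fun n => Cmod (a n)) ->
  ex_series (fun n => Rabs (Re (a n))) /\ ex_series (fun n => Rabs (Im (a n))).
Proof.
  intros H; split;
    apply (@ex_series_le R_AbsRing R_CompleteNormedModule) with (2 := H);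
    intros n; change norm with Rabs; rewrite Rabs_Rabsolu;
    [apply re_le_Cmod|apply im_le_Cmod].
Qed.

Lemma is_Cseries_abs (a : nat -> C) :
  ex_series (fun n => Cmod (a n)) -> exists l, is_Cseries a l.
Proof.
  intros H; destruct (ex_series_Re_Im a H) as [H1 H2].
  apply ex_series_Rabs in H1, H2; destruct H1 as [x Hx], H2 as [y Hy].
  now exists (x, y).
Qed.

Lemma Cmod_le_Re_Im (z : C) : (Cmod z <= Rabs (Re z) + Rabs (Im z))%R.
Proof.
  destruct z as [x y].
  assert (E : ((x, y) : C) = RtoC x + Ci * RtoC y)
    by (apply injective_projections; simpl; ring).
  rewrite E at 1.
  eapply Rle_trans; [apply Cmod_triangle|].
  rewrite Cmod_mult, Cmod_Ci, !Cmod_R; simpl; lra.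
Qed.

(** The factor 2 is the cost of bounding real and imaginary parts separately by [m]. *)
Lemma Cmod_Cseries_le (a : nat -> C) (b : nat -> R) (l : C) (m : R) :
  is_Cseries a l -> is_series b m -> (forall n, (Cmod (a n) <= b n)%R) ->
  (Cmod l <= 2 * m)%R.
Proof.
  intros [H1 H2] Hb Hab.
  assert (Hc : forall u : nat -> R, (forall n, Rabs (u n) <= b n)%R ->
                 forall x, is_series u x -> (Rabs x <= m)%R).
  { intros u Hu x Hx.
    assert (E : ex_series (fun n => Rabs (u n))).
    { apply (@ex_series_le R_AbsRing R_CompleteNormedModule) with b;
        [|now exists m].
      intros n; change norm with Rabs; rewrite Rabs_Rabsolu; apply Hu. }
    rewrite <- (is_series_unique _ _ Hx), <- (is_series_unique _ _ Hb).
    eapply Rle_trans; [now apply Series_Rabs|].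
    apply Series_le; [|now exists m].
    intros n; split; [apply Rabs_pos|apply Hu]. }
  assert (Rabs (Re l) <= m)%R.
  { apply Hc with (2 := H1); intros n.
    eapply Rle_trans; [apply re_le_Cmod|apply Hab]. }
  assert (Rabs (Im l) <= m)%R.
  { apply Hc with (2 := H2); intros n.
    eapply Rle_trans; [apply im_le_Cmod|apply Hab]. }
  generalize (Cmod_le_Re_Im l); lra.
Qed.

Lemma is_Cseries_bounded (a : nat -> C) (l : C) :
  is_Cseries a l -> exists M, forall n, (Cmod (a n) <= M)%R.
Proof.
  assert (Hb : forall (u : nat -> R) x, is_series u x ->
                 exists M, forall n, (Rabs (u n) <= M)%R).
  { intros u x Hu.
    assert (L : is_lim_seq u 0) by (apply ex_series_lim_0; now exists x).
    destruct (maj_by_pos u) as [M [_ HM]].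
    { exists R0; now apply is_lim_seq_Reals. }
    now exists M. }
  intros [H1 H2]; destruct (Hb _ _ H1) as [M1 HM1], (Hb _ _ H2) as [M2 HM2].
  exists (M1 + M2)%R; intros n.
  generalize (Cmod_le_Re_Im (a n)) (HM1 n) (HM2 n); lra.
Qed.

Definition conv (a b : nat -> C) (n : nat) : C :=
  @sum_n C_Ring (fun k => a k * b (n - k)%nat) n.

(* Mertens' theorem, from its real version applied to real and imaginary parts. *)
Lemma is_Cseries_conv (a b : nat -> C) (la lb : C) :
  is_Cseries a la -> is_Cseries b lb ->
  ex_series (fun n => Cmod (a n)) -> ex_series (fun n => Cmod (b n)) ->
  is_Cseries (conv a b) (la * lb).
Proof.
  intros [A1 A2] [B1 B2] HA HB.
  destruct (ex_series_Re_Im a HA) as [A3 A4].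
  destruct (ex_series_Re_Im b HB) as [B3 B4].
  assert (RR := is_series_mult _ _ _ _ A1 B1 A3 B3).
  assert (II := is_series_mult _ _ _ _ A2 B2 A4 B4).
  assert (RI := is_series_mult _ _ _ _ A1 B2 A3 B4).
  assert (IR := is_series_mult _ _ _ _ A2 B1 A4 B3).
  split.
  - generalize (is_series_minus _ _ _ _ RR II); apply is_series_ext; intros n.
    unfold conv; rewrite Re_sum_n.
    unfold minus, plus, opp; simpl.
    rewrite sum_n_Reals.
    apply (eq_trans (eq_sym (minus_sum _ _ _))); reflexivity.
  - generalize (is_series_plus _ _ _ _ RI IR); apply is_series_ext; intros n.
    unfold conv; rewrite Im_sum_n.
    rewrite sum_n_Reals.
    apply (eq_trans (eq_sym (plus_sum _ _ _))); reflexivity.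
Qed.

(** * Analytic functions of one variable *)

(* The Cauchy bound on the coefficients makes the series absolutely convergent
   on the whole open disc. *)
Definition expands (f : C -> C) (z0 : C) (a : nat -> C) (M r : R) : Prop :=
  (0 < r)%R /\ (forall n, (Cmod (a n) * r ^ n <= M)%R) /\
  forall w, (Cmod w < r)%R -> is_Cseries (fun n => a n * w ^ n) (f (z0 + w)).

Lemma analytic_at_intro (f : C -> C) (z0 : C) (a : nat -> C) (r : R) :
  (0 < r)%R ->
  (forall w, (Cmod w < r)%R -> is_Cseries (fun n => a n * w ^ n) (f (z0 + w))) ->
  analytic_at f z0.
Proof.
  intros Hr H; exists (mkposreal r Hr), a; intros z Hz.
  apply is_pseries_C.
  replace (f z) with (f (z0 + (z - z0))) by (f_equal; ring).
  now apply H.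
Qed.

Lemma expands_shrink (f : C -> C) (z0 : C) (a : nat -> C) (M r r' : R) :
  expands f z0 a M r -> (0 < r' <= r)%R -> expands f z0 a M r'.
Proof.
  intros (Hr & HM & H) [H0 H1]; split; [|split]; trivial.
  - intros n; eapply Rle_trans; [|apply HM].
    apply Rmult_le_compat_l; [apply Cmod_ge_0|apply pow_incr; lra].
  - intros w Hw; apply H; lra.
Qed.

Lemma analytic_at_expands (f : C -> C) (z0 : C) :
  analytic_at f z0 -> exists a M r, expands f z0 a M r.
Proof.
  intros ([r Hr] & a & H); simpl in H.
  assert (H' : forall w, (Cmod w < r)%R ->
                 is_Cseries (fun n => a n * w ^ n) (f (z0 + w))).
  { intros w Hw; apply is_pseries_C.
    replace w with (z0 + w - z0) at 1 by ring.
    apply H; now replace (z0 + w - z0) with w by ring. }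
  (* The terms of a convergent series are bounded, so convergence at the point [r / 2] yields the
     coefficient bound, at the price of half the radius. *)
  assert (Hm : (Cmod (RtoC (r / 2)) < r)%R)
    by (rewrite Cmod_R, Rabs_pos_eq; lra).
  destruct (is_Cseries_bounded _ _ (H' _ Hm)) as [M HM].
  exists a, M, (r / 2)%R; split; [|split]; [lra| |].
  - intros n; generalize (HM n).
    now rewrite Cmod_mult, Cmod_pow, Cmod_R, (Rabs_pos_eq (r / 2)) by lra.
  - intros w Hw; apply H'; lra.
Qed.

Lemma bounded_coeff_term (a : nat -> C) (M r : R) (w : C) :
  (0 < r)%R -> (forall n, (Cmod (a n) * r ^ n <= M)%R) ->
  forall n, (Cmod (a n * w ^ n) <= M * (Cmod w / r) ^ n)%R.
Proof.
  intros Hr HM n.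
  assert (Hp := pow_lt r n Hr).
  rewrite Cmod_mult, Cmod_pow; unfold Rdiv; rewrite Rpow_mult_distr, pow_inv.
  assert (0 <= Cmod w ^ n)%R by (apply pow_le, Cmod_ge_0).
  replace (Cmod (a n) * Cmod w ^ n)%R
    with (Cmod (a n) * r ^ n * (Cmod w ^ n * / r ^ n))%R by (field; lra).
  apply Rmult_le_compat_r; [|apply HM].
  apply Rmult_le_pos; [trivial|now apply Rlt_le, Rinv_0_lt_compat].
Qed.

Lemma bounded_coeff_abs (a : nat -> C) (M r : R) (w : C) :
  (0 < r)%R -> (forall n, (Cmod (a n) * r ^ n <= M)%R) -> (Cmod w < r)%R ->
  ex_series (fun n => Cmod (a n * w ^ n)).
Proof.
  intros Hr HM Hw.
  apply (@ex_series_le R_AbsRing R_CompleteNormedModule)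
    with (fun n => M * (Cmod w / r) ^ n)%R.
  - intros n; change norm with Rabs.
    rewrite (Rabs_pos_eq _ (Cmod_ge_0 _)); now apply bounded_coeff_term.
  - apply (@ex_series_scal_l R_AbsRing R_NormedModule), ex_series_geom.
    assert (0 <= Cmod w / r)%R by (apply Rdiv_le_0_compat; [apply Cmod_ge_0|lra]).
    rewrite Rabs_pos_eq by trivial.
    apply Rmult_lt_reg_r with r; [lra|].
    unfold Rdiv; rewrite Rmult_assoc, Rinv_l by lra; lra.
Qed.

Lemma analytic_at_expands2 (f g : C -> C) (z0 : C) :
  analytic_at f z0 -> analytic_at g z0 ->
  exists a b M N r, expands f z0 a M r /\ expands g z0 b N r.
Proof.
  intros Hf Hg.
  destruct (analytic_at_expands _ _ Hf) as (a & M & r1 & Ha).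
  destruct (analytic_at_expands _ _ Hg) as (b & N & r2 & Hb).
  assert (H1 := proj1 Ha); assert (H2 := proj1 Hb).
  assert (0 < Rmin r1 r2)%R by (now apply Rmin_pos).
  exists a, b, M, N, (Rmin r1 r2).
  split; eapply expands_shrink; eauto; split; auto; [apply Rmin_l|apply Rmin_r].
Qed.

Lemma analytic_at_ext (f g : C -> C) (z0 : C) (d : R) :
  (0 < d)%R -> (forall w, (Cmod w < d)%R -> f (z0 + w) = g (z0 + w)) ->
  analytic_at f z0 -> analytic_at g z0.
Proof.
  intros Hd E Hf; destruct (analytic_at_expands _ _ Hf) as (a & M & r & Hr & _ & H).
  apply analytic_at_intro with a (Rmin r d); [now apply Rmin_pos|].
  intros w Hw; rewrite <- E.
  - apply H; eapply Rlt_le_trans; [apply Hw|apply Rmin_l].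
  - eapply Rlt_le_trans; [apply Hw|apply Rmin_r].
Qed.

Lemma analytic_at_plus (f g : C -> C) (z0 : C) :
  analytic_at f z0 -> analytic_at g z0 -> analytic_at (fun z => f z + g z) z0.
Proof.
  intros Hf Hg.
  destruct (analytic_at_expands2 _ _ _ Hf Hg)
    as (a & b & M & N & r & (Hr & _ & Ha) & (_ & _ & Hb)).
  apply analytic_at_intro with (fun n => a n + b n) r; trivial.
  intros w Hw; generalize (is_Cseries_plus _ _ _ _ (Ha w Hw) (Hb w Hw)).
  apply is_Cseries_ext; intros n; ring.
Qed.

Lemma conv_pow (a b : nat -> C) (w : C) (n : nat) :
  conv (fun n => a n * w ^ n) (fun n => b n * w ^ n) n = conv a b n * w ^ n.
Proof.
  unfold conv.
  etransitivity; [|apply (@sum_n_mult_r C_Ring)].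
  apply sum_n_ext_loc; intros k Hk.
  change mult with Cmult.
  replace (w ^ n) with (w ^ k * w ^ (n - k)); [simpl; ring|].
  rewrite <- Cpow_add_r; f_equal; lia.
Qed.

Lemma analytic_at_mult (f g : C -> C) (z0 : C) :
  analytic_at f z0 -> analytic_at g z0 -> analytic_at (fun z => f z * g z) z0.
Proof.
  intros Hf Hg.
  destruct (analytic_at_expands2 _ _ _ Hf Hg)
    as (a & b & M & N & r & (Hr & HM & Ha) & (_ & HN & Hb)).
  apply analytic_at_intro with (conv a b) r; trivial.
  intros w Hw.
  eapply is_Cseries_ext; [apply conv_pow|].
  apply is_Cseries_conv; auto; eapply bounded_coeff_abs; eauto.
Qed.

Lemma is_Cseries_finite (a : nat -> C) (N : nat) :
  (forall n, (N < n)%nat -> a n = 0) -> is_Cseries a (@sum_n C_Ring a N).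
Proof.
  intros H; apply is_series_C.
  apply filterlim_ext_loc with (fun _ => @sum_n C_Ring a N);
    [|apply filterlim_const].
  exists N; intros n Hn; induction Hn as [|n Hn IH]; [reflexivity|].
  rewrite sum_Sn, H by lia.
  rewrite <- IH; symmetry; apply (@plus_zero_r C_Ring).
Qed.

Lemma analytic_at_const (c z0 : C) : analytic_at (fun _ => c) z0.
Proof.
  apply analytic_at_intro with (fun n => match n with O => c | _ => 0 end) R1;
    [lra|].
  intros w _.
  assert (E : c = @sum_n C_Ring
                (fun n => match n with O => c | _ => 0 end * w ^ n) 0)
    by (rewrite sum_O; simpl; ring).
  refine (eq_ind_r (is_Cseries _) _ E); apply is_Cseries_finite.
  intros [|n] Hn; [lia|ring].
Qed.

Lemma analytic_at_id (z0 : C) : analytic_at (fun z => z) z0.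
Proof.
  set (a := fun n => match n with O => z0 | S O => 1 | _ => 0 end).
  apply analytic_at_intro with a R1; [lra|].
  intros w _.
  replace (z0 + w) with (@sum_n C_Ring (fun n => a n * w ^ n) 1).
  - apply is_Cseries_finite.
    intros [|[|n]] Hn; [lia|lia|simpl; ring].
  - rewrite sum_Sn, sum_O; change plus with Cplus; simpl; ring.
Qed.

Lemma analytic_at_opp (f : C -> C) (z0 : C) :
  analytic_at f z0 -> analytic_at (fun z => - f z) z0.
Proof.
  intros H; apply analytic_at_ext with (fun z => - (1) * f z) R1; [lra| |].
  - intros w _; ring.
  - apply analytic_at_mult; [apply analytic_at_const|trivial].
Qed.

Lemma analytic_at_minus (f g : C -> C) (z0 : C) :
  analytic_at f z0 -> analytic_at g z0 -> analytic_at (fun z => f z - g z) z0.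
Proof. intros Hf Hg; now apply analytic_at_plus, analytic_at_opp. Qed.

Lemma analytic_at_Csum (s : list C) (g : C -> C -> C) (z0 : C) :
  (forall x, In x s -> analytic_at (g x) z0) ->
  analytic_at (fun z => Csum s (fun x => g x z)) z0.
Proof.
  induction s as [|x s IH]; intros H.
  - exact (analytic_at_const 0 z0).
  - apply (analytic_at_plus (g x) (fun z => Csum s (fun x => g x z))).
    + apply H; now left.
    + apply IH; intros y Hy; apply H; now right.
Qed.

Lemma analytic_at_affine (f : C -> C) (b p z0 : C) :
  analytic_at f (b * (z0 - p)) -> analytic_at (fun z => f (b * (z - p))) z0.
Proof.
  intros H; destruct (analytic_at_expands _ _ H) as (a & M & r & Hr & _ & Ha).
  assert (Hc := Cmod_ge_0 b).
  (* Adding 1 to [Cmod b] covers [b = 0]. *)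
  apply analytic_at_intro with (fun n => a n * b ^ n) (r / (Cmod b + 1))%R.
  - apply Rdiv_lt_0_compat; lra.
  - intros w Hw.
    apply is_Cseries_ext with (fun n => a n * (b * w) ^ n);
      [intros n; rewrite Cpow_mult_l; ring|].
    replace (b * (z0 + w - p)) with (b * (z0 - p) + b * w) by ring.
    apply Ha; rewrite Cmod_mult.
    apply Rmult_lt_compat_r with (r := (Cmod b + 1)%R) in Hw; [|lra].
    unfold Rdiv in Hw; rewrite Rmult_assoc, Rinv_l in Hw by lra.
    generalize (Cmod_ge_0 w); nra.
Qed.

Lemma expands_value (f : C -> C) (z0 : C) (a : nat -> C) (M r : R) :
  expands f z0 a M r -> f z0 = a O.
Proof.
  intros (Hr & _ & H).
  assert (H0 := H 0); rewrite Cmod_0 in H0; specialize (H0 Hr).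
  rewrite Cplus_0_r in H0; apply is_Cseries_unique with (1 := H0).
  replace (a O) with (@sum_n C_Ring (fun n => a n * 0 ^ n) 0)
    by (rewrite sum_O; simpl; ring).
  apply is_Cseries_finite; intros [|n] Hn; [lia|simpl; ring].
Qed.

(** Dropping the constant term and shifting the coefficients divides the series of [f z - f z0] by
    [z - z0]; the value filled in at [z0] is the derivative [a 1]. *)
Lemma expands_divided_difference (f : C -> C) (z0 : C) (a : nat -> C) (M r : R) :
  expands f z0 a M r ->
  analytic_at
    (fun z => if Ceq_dec z z0 then a 1%nat else (f z - f z0) / (z - z0)) z0.
Proof.
  intros HE; assert (E0 := expands_value _ _ _ _ _ HE).
  destruct HE as (Hr & HM & H).
  apply analytic_at_intro with (fun n => a (S n)) r; trivial.
  intros w Hw; destruct (Ceq_dec (z0 + w) z0) as [E|E].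
  - assert (w = 0) as -> by (replace w with (z0 + w - z0) by ring; rewrite E; ring).
    replace (a 1%nat) with (@sum_n C_Ring (fun n => a (S n) * 0 ^ n) 0)
      by (rewrite sum_O; simpl; ring).
    apply is_Cseries_finite; intros [|n] Hn; [lia|simpl; ring].
  - assert (w <> 0) by (intros ->; apply E; ring).
    generalize (proj2 (is_pseries_C _ _ _) (H w Hw)); intros P.
    apply is_pseries_decr_1 with (y := / w) in P; [|now apply Cinv_l].
    apply is_pseries_C in P.
    replace ((f (z0 + w) - f z0) / (z0 + w - z0))
      with (/ w * (f (z0 + w) + - a O)); [exact P|].
    rewrite E0; replace (z0 + w - z0) with w by ring; now field.
Qed.

Lemma analytic_at_divided_difference (f : C -> C) (z0 : C) :
  analytic_at f z0 ->
  exists c, analytic_at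
              (fun z => if Ceq_dec z z0 then c else (f z - f z0) / (z - z0)) z0.
Proof.
  intros Hf; destruct (analytic_at_expands _ _ Hf) as (a & M & r & HE).
  exists (a 1%nat); now apply expands_divided_difference with M r.
Qed.

(** The divided difference is analytic, hence bounded near [z0], and its bound is a Lipschitz
    constant. *)
Lemma analytic_at_Lipschitz (f : C -> C) (z0 : C) :
  analytic_at f z0 ->
  exists L d, (0 < L)%R /\ (0 < d)%R /\
    forall z, (Cmod (z - z0) < d)%R -> (Cmod (f z - f z0) <= L * Cmod (z - z0))%R.
Proof.
  intros Hf; destruct (analytic_at_divided_difference _ _ Hf) as [c Hg].
  set (g := fun z => if Ceq_dec z z0 then c else (f z - f z0) / (z - z0)) in Hg.
  destruct (analytic_at_expands _ _ Hg) as (a & M & r & Hr & HM & H).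
  assert (HM0 : (0 <= M)%R).
  { eapply Rle_trans; [|apply (HM O)]; simpl; generalize (Cmod_ge_0 (a O)); lra. }
  assert (B : forall w, (Cmod w < r / 2)%R -> (Cmod (g (z0 + w)%C) <= 4 * M)%R).
  (* On the half disc the terms are at most [M * (/ 2) ^ n], with sum [2 * M]; the other factor 2
     comes from [Cmod_Cseries_le]. *)
  { intros w Hw; replace (4 * M)%R with (2 * (M * / (1 - / 2)))%R by field.
    apply Cmod_Cseries_le with (fun n => a n * w ^ n) (fun n => M * (/ 2) ^ n)%R.
    - apply H; lra.
    - apply (@is_series_scal_l R_AbsRing R_NormedModule), is_series_geom.
      rewrite Rabs_pos_eq; lra.
    - intros n; eapply Rle_trans; [apply (bounded_coeff_term a M r); trivial|].
      apply Rmult_le_compat_l; trivial.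
      apply pow_incr; split.
      + apply Rdiv_le_0_compat; [apply Cmod_ge_0|lra].
      + apply Rmult_le_reg_r with r; [lra|].
        unfold Rdiv; rewrite Rmult_assoc, Rinv_l by lra; lra. }
  (* The added 1 makes the constant positive even if [M = 0]. *)
  exists (4 * M + 1)%R, (r / 2)%R; split; [|split]; [lra|lra|].
  intros z Hz; assert (Bz := B _ Hz).
  replace (z0 + (z - z0)) with z in Bz by ring; unfold g in Bz.
  generalize (Cmod_ge_0 (z - z0)); intros P.
  destruct (Ceq_dec z z0) as [->|E].
  - unfold Cminus; rewrite !Cplus_opp_r, Cmod_0; lra.
  - assert (z - z0 <> 0) by (intros K; apply E;
      replace z with (z - z0 + z0) by ring; rewrite K; ring).
    replace (f z - f z0) with ((f z - f z0) / (z - z0) * (z - z0)) by now field.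
    rewrite Cmod_mult; nra.
Qed.

Lemma analytic_at_neq_0 (f : C -> C) (z0 : C) :
  analytic_at f z0 -> f z0 <> 0 ->
  exists d, (0 < d)%R /\ forall z, (Cmod (z - z0) < d)%R -> f z <> 0.
Proof.
  intros Hf H0; destruct (analytic_at_Lipschitz _ _ Hf) as (L & d & HL & Hd & H).
  apply Cmod_gt_0 in H0.
  assert (0 < Cmod (f z0) / L)%R by now apply Rdiv_lt_0_compat.
  exists (Rmin d (Cmod (f z0) / L)); split; [now apply Rmin_pos|].
  intros z Hz E.
  assert (Hz1 := Rlt_le_trans _ _ _ Hz (Rmin_l _ _)).
  assert (Hz2 := Rlt_le_trans _ _ _ Hz (Rmin_r _ _)).
  specialize (H z Hz1); rewrite E in H.
  replace (0 - f z0) with (- f z0) in H by ring; rewrite Cmod_opp in H.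
  apply Rmult_lt_compat_r with (r := L) in Hz2; trivial.
  unfold Rdiv in Hz2; rewrite Rmult_assoc, Rinv_l in Hz2 by lra; lra.
Qed.

(* Coefficients of the reciprocal series, by the recursion
   [b (n+1) = - / a 0 * \sum_(j <= n) a (n+1-j) * b j]; entry [k <= n] of
   [inv_coeffs a n] does not depend on [n]. *)
Fixpoint inv_coeffs (a : nat -> C) (n k : nat) : C :=
  match n with
  | O => / a O
  | S m => if Nat.leb k m then inv_coeffs a m k else
             - / a O * @sum_n C_Ring (fun j => a (S m - j)%nat * inv_coeffs a m j) m
  end.

Lemma inv_coeffs_stable (a : nat -> C) (n k : nat) :
  (k <= n)%nat -> inv_coeffs a n k = inv_coeffs a k k.
Proof.
  induction 1 as [|n Hn IH]; [reflexivity|].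
  rewrite <- IH; simpl; now rewrite (leb_correct _ _ Hn).
Qed.

Lemma inv_coeffs_S (a : nat -> C) (n : nat) :
  inv_coeffs a (S n) (S n) =
  - / a O * @sum_n C_Ring (fun j => a (S n - j)%nat * inv_coeffs a j j) n.
Proof.
  cbn [inv_coeffs]; rewrite (leb_correct_conv n (S n)) by lia; f_equal.
  apply sum_n_ext_loc; intros k Hk; now rewrite (inv_coeffs_stable a n k).
Qed.

Lemma conv_inv_coeffs (a : nat -> C) (n : nat) :
  a O <> 0 ->
  conv (fun k => inv_coeffs a k k) a n = match n with O => 1 | _ => 0 end.
Proof.
  intros H0; unfold conv; destruct n as [|n].
  - rewrite sum_O; simpl; now field.
  - rewrite sum_Sn, inv_coeffs_S, Nat.sub_diag.
    rewrite (sum_n_ext _ (fun j => a (S n - j)%nat * inv_coeffs a j j))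
      by (intros j; apply Cmult_comm).
    set (s := sum_n _ n); change plus with Cplus; now field.
Qed.

Lemma Cmod_sum_n_geom (u : nat -> C) (m N : R) (n : nat) :
  (forall j, (j <= n)%nat -> (Cmod (u j) <= m * (N * (1 + m) ^ j))%R) ->
  (Cmod (@sum_n C_Ring u n) <= N * ((1 + m) ^ S n - 1))%R.
Proof.
  induction n as [|n IH]; intros H.
  - rewrite sum_O; generalize (H O (le_n _)); simpl; lra.
  - rewrite sum_Sn; eapply Rle_trans; [apply Cmod_triangle|].
    generalize (IH (fun j Hj => H j (le_S _ _ Hj))) (H _ (le_n _)); simpl; lra.
Qed.

(** With [m = M / Cmod (a O)], the induction hypothesis bounds the recursion by a multiple of the
    sum of [m * (1 + m) ^ j] over [j <= n], which telescopes to [(1 + m) ^ S n - 1]. The ratio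
    [1 + m] is chosen so that the bound reproduces itself. *)
Lemma inv_coeffs_bound (a : nat -> C) (M r : R) :
  (0 < r)%R -> a O <> 0 -> (forall n, (Cmod (a n) * r ^ n <= M)%R) ->
  forall n, (Cmod (inv_coeffs a n n) * r ^ n <=
             / Cmod (a O) * (1 + M / Cmod (a O)) ^ n)%R.
Proof.
  intros Hr H0 HM n; apply Cmod_gt_0 in H0 as Hp.
  assert (Hi := Rinv_0_lt_compat _ Hp).
  induction n as [n IH] using lt_wf_ind; destruct n as [|n].
  - simpl; rewrite Cmod_inv by trivial; lra.
  - rewrite inv_coeffs_S, Cmod_mult, Cmod_opp, Cmod_inv by trivial.
    set (m := (M / Cmod (a O))%R) in *; set (N := (/ Cmod (a O))%R) in *.
    rewrite Rmult_assoc; apply Rmult_le_compat_l; [lra|].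
    replace (r ^ S n)%R with (Cmod (r ^ S n)%R)
      by (rewrite Cmod_R; apply Rabs_pos_eq, Rlt_le, pow_lt, Hr).
    rewrite <- Cmod_mult, <- (@sum_n_mult_r C_Ring).
    apply Rle_trans with (1 * ((1 + m) ^ S n - 1))%R; [|lra].
    apply Cmod_sum_n_geom; intros j Hj.
    change mult with Cmult.
    replace (r ^ S n)%R with (r ^ (S n - j) * r ^ j)%R
      by (rewrite <- pow_add; f_equal; lia).
    rewrite RtoC_mult, !Cmod_mult, !Cmod_R.
    rewrite !(Rabs_pos_eq (r ^ _)) by apply Rlt_le, pow_lt, Hr.
    generalize (HM (S n - j)%nat) (IH j (proj2 (Nat.lt_succ_r _ _) Hj)).
    set (A := (Cmod (a (S n - j)%nat))%R).
    assert (M = m * / N)%R by (unfold m, N; field; lra).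
    set (P := (r ^ (S n - j))%R); set (Q := (r ^ j)%R).
    intros H1 H2.
    replace (A * Cmod (inv_coeffs a j j) * (P * Q))%R
      with ((A * P) * (Cmod (inv_coeffs a j j) * Q))%R by ring.
    replace (m * (1 * (1 + m) ^ j))%R with (M * (N * (1 + m) ^ j))%R
      by (rewrite H; field; lra).
    apply Rmult_le_compat; trivial; apply Rmult_le_pos; try apply Cmod_ge_0;
      apply Rlt_le, pow_lt, Hr.
Qed.

Lemma analytic_at_inv (f : C -> C) (z0 : C) :
  analytic_at f z0 -> f z0 <> 0 -> analytic_at (fun z => / f z) z0.
Proof.
  intros Hf H0; destruct (analytic_at_expands _ _ Hf) as (a & M & r & HE).
  rewrite (expands_value _ _ _ _ _ HE) in H0.
  destruct HE as (Hr & HM & H).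
  apply Cmod_gt_0 in H0 as Hp; assert (Hi := Rinv_0_lt_compat _ Hp).
  set (m := (M / Cmod (a O))%R).
  assert (Hm : (0 <= m)%R).
  { apply Rdiv_le_0_compat; trivial.
    generalize (HM O); simpl; lra. }
  (* This radius absorbs the growth [(1 + m) ^ n] of the reciprocal coefficients. *)
  set (s := (r / (1 + m))%R).
  assert (Hs : (0 < s)%R) by (apply Rdiv_lt_0_compat; lra).
  assert (Hsr : (s <= r)%R).
  { apply Rmult_le_reg_r with (1 + m)%R; [lra|].
    unfold s, Rdiv; rewrite Rmult_assoc, Rinv_l by lra; nra. }
  set (b := fun n => inv_coeffs a n n).
  assert (Hb : forall n, (Cmod (b n) * s ^ n <= / Cmod (a O))%R).
  { intros n; unfold s, Rdiv; rewrite Rpow_mult_distr, pow_inv, <- Rmult_assoc.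
    assert (0 < (1 + m) ^ n)%R by (apply pow_lt; lra).
    apply Rmult_le_reg_r with ((1 + m) ^ n)%R; trivial.
    rewrite Rmult_assoc, Rinv_l, Rmult_1_r by lra.
    now apply inv_coeffs_bound. }
  apply analytic_at_intro with b s; trivial.
  intros w Hw.
  assert (Ab := bounded_coeff_abs _ _ _ w Hs Hb Hw).
  assert (Aa := bounded_coeff_abs _ _ _ w Hr HM (Rlt_le_trans _ _ _ Hw Hsr)).
  destruct (is_Cseries_abs _ Ab) as [l Hl].
  assert (Ha := H w (Rlt_le_trans _ _ _ Hw Hsr)).
  assert (P := is_Cseries_conv _ _ _ _ Hl Ha Ab Aa).
  assert (E : l * f (z0 + w) = 1).
  { apply is_Cseries_unique with (1 := P).
    replace (RtoC 1) with
      (@sum_n C_Ring (fun n => match n with O => 1 | _ => 0 end * w ^ n) 0)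
      by (rewrite sum_O; simpl; ring).
    apply is_Cseries_ext with
      (fun n => match n with O => 1 | _ => 0 end * w ^ n).
    { intros n; rewrite conv_pow; unfold b; now rewrite conv_inv_coeffs. }
    apply is_Cseries_finite; intros [|n] Hn; [lia|ring]. }
  replace (/ f (z0 + w)) with l; trivial.
  (* The product formula itself excludes zeros of [f] throughout the disc. *)
  assert (f (z0 + w) <> 0).
  { intros K; rewrite K, Cmult_0_r in E.
    apply (f_equal Re) in E; simpl in E; lra. }
  replace l with (l * f (z0 + w) * / f (z0 + w)) by now field.
  rewrite E; ring.
Qed.

(** * The exponential and the poles of the Fermi function *)

Lemma Cexp_plus (x y : C) : Cexp (x + y) = Cexp x * Cexp y.
Proof.
  unfold Cexp; destruct x as [a b], y as [c d]; unfold Re, Im; simpl.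
  rewrite exp_plus, cos_plus, sin_plus.
  apply injective_projections; simpl; ring.
Qed.

Definition exp_term (z : C) (n : nat) : C := RtoC (/ INR (fact n)) * z ^ n.

Lemma exp_term_S (z : C) (n : nat) :
  RtoC (INR (S n)) * exp_term z (S n) = z * exp_term z n.
Proof.
  assert (H1 := INR_fact_neq_0 n); assert (H2 := not_0_INR (S n) (Nat.neq_succ_0 n)).
  unfold exp_term; change (fact (S n)) with (S n * fact n)%nat.
  rewrite mult_INR, Rinv_mult, RtoC_mult, !RtoC_inv, Cpow_S by trivial.
  field; split; intros E; apply RtoC_inj in E; now auto.
Qed.

Lemma sum_n_C_S (u : nat -> C) (n : nat) :
  @sum_n C_Ring u (S n) = u O + @sum_n C_Ring (fun k => u (S k)) n.
Proof.
  induction n as [|n IH].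
  - now rewrite sum_Sn, !sum_O.
  - rewrite sum_Sn, IH, sum_Sn; symmetry; apply Cplus_assoc.
Qed.

(* Multiplying by [n + 1 = k + (n + 1 - k)] inside the sum gives the
   recursion that characterizes [exp_term (x + y)]. *)
Lemma conv_exp_term (x y : C) (n : nat) :
  conv (exp_term x) (exp_term y) n = exp_term (x + y) n.
Proof.
  assert (Hn0 : forall n, RtoC (INR (S n)) <> 0)
    by (intros m E; apply (not_0_INR (S m)); [lia|now apply RtoC_inj]).
  induction n as [|n IH].
  - unfold conv; rewrite sum_O; unfold exp_term; simpl.
    rewrite Rinv_1; ring.
  - set (N := RtoC (INR (S n))).
    enough (E : N * conv (exp_term x) (exp_term y) (S n) = N * exp_term (x + y) (S n)).
    { rewrite <- (Cmult_1_l (conv _ _ _)), <- (Cmult_1_l (exp_term _ _)).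
      rewrite <- (Cinv_l N), <- !Cmult_assoc, E by apply Hn0; reflexivity. }
    unfold N at 2; rewrite exp_term_S, <- IH.
    unfold conv; etransitivity; [symmetry; apply (@sum_n_mult_l C_Ring)|].
    transitivity
      (@sum_n C_Ring
         (fun k => RtoC (INR k) * exp_term x k * exp_term y (S n - k)) (S n) +
       @sum_n C_Ring
         (fun k => RtoC (INR (S n - k)) * exp_term y (S n - k) * exp_term x k) (S n)).
    { etransitivity; [|apply (@sum_n_plus C_Ring)].
      apply sum_n_ext_loc; intros k Hk.
      change mult with Cmult; change plus with Cplus; unfold N.
      replace (INR (S n)) with (INR k + INR (S n - k))%R
        by (rewrite <- plus_INR; f_equal; lia).
      rewrite RtoC_plus.
      match goal with |- @eq _ ?u ?v => change (@eq C u v) end; ring. }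
    rewrite Cmult_plus_distr_r; f_equal.
    + rewrite sum_n_C_S; change (INR 0) with R0.
      rewrite !Cmult_0_l, Cplus_0_l.
      etransitivity; [|apply (@sum_n_mult_l C_Ring)].
      apply sum_n_ext; intros k.
      rewrite exp_term_S; change mult with Cmult; cbn [Nat.sub].
      symmetry; apply Cmult_assoc.
    + rewrite sum_Sn, Nat.sub_diag; change (INR 0) with R0.
      rewrite !Cmult_0_l; change plus with Cplus; rewrite Cplus_0_r.
      etransitivity; [|apply (@sum_n_mult_l C_Ring)].
      apply sum_n_ext_loc; intros k Hk.
      rewrite Nat.sub_succ_l, exp_term_S by trivial; change mult with Cmult.
      rewrite (Cmult_comm (exp_term x k)); symmetry; apply Cmult_assoc.
Qed.

Lemma ex_series_exp_term (z : C) : ex_series (fun n => Cmod (exp_term z n)).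
Proof.
  exists (exp (Cmod z)); generalize (is_exp_Reals (Cmod z)); intros H.
  apply is_pseries_R in H; revert H; apply is_series_ext; intros n.
  unfold exp_term; rewrite Cmod_mult, Cmod_pow, Cmod_R, Rabs_pos_eq; trivial.
  apply Rlt_le, Rinv_0_lt_compat, INR_fact_lt_0.
Qed.

Lemma is_series_0 : is_series (fun _ => 0%R) 0%R.
Proof.
  apply is_series_Reals; intros eps He; exists O; intros n _.
  rewrite sum_cte, Rmult_0_l; unfold Rdist; rewrite Rminus_0_r, Rabs_R0; lra.
Qed.

Lemma exp_term_real (x : R) : is_Cseries (exp_term x) (exp x).
Proof.
  generalize (proj1 (is_pseries_R _ _ _) (is_exp_Reals x)); intros H.
  assert (E : forall n, exp_term x n = RtoC (/ INR (fact n) * x ^ n)).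
  { intros n; unfold exp_term; rewrite RtoC_mult, RtoC_pow; reflexivity. }
  split.
  - revert H; apply is_series_ext; intros n; now rewrite E.
  - generalize is_series_0; apply is_series_ext; intros n; now rewrite E.
Qed.

Lemma Ci_pow_even (n : nat) : Ci ^ (2 * n) = RtoC ((-1) ^ n).
Proof.
  rewrite Cpow_mult_r, RtoC_pow; f_equal.
  apply injective_projections; simpl; ring.
Qed.

(* Coquelicot's extensionality lemmas leave equations at [NormedModule.sort _ _],
   which [ring] and [field] do not recognize as equations in [R]. *)
Ltac as_R_eq := match goal with |- @eq _ ?u ?v => change (@eq R u v) end.

(** The powers of [Ci] split the series by parity: the even terms form the series that defines
    [cos], the odd ones [y] times the series that defines [sin]. In each component the other half
    vanishes. *)
Lemma exp_term_imag (y : R) : is_Cseries (exp_term (Ci * y)) (cos y, sin y).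
Proof.
  assert (E : forall n, exp_term (Ci * y) n =
                RtoC (/ INR (fact n) * y ^ n) * Ci ^ n).
  { intros n; unfold exp_term; rewrite Cpow_mult_l, RtoC_mult, RtoC_pow; ring. }
  assert (Z : is_pseries (fun _ : nat => 0%R) (y ^ 2)%R 0%R).
  { apply is_pseries_R; generalize is_series_0; apply is_series_ext; intros n.
    symmetry; apply Rmult_0_l. }
  split; unfold Re, Im, fst, snd.
  - apply is_series_ext with
      (fun n => / INR (fact n) * Re (Ci ^ n) * y ^ n)%R.
    { intros n; rewrite E; simpl; unfold Re; as_R_eq; ring. }
    apply is_pseries_R.
    replace (cos y) with (cos y + y * 0)%R by ring.
    apply is_pseries_odd_even.
    + apply is_pseries_R; unfold cos; destruct (exist_cos (Rsqr y)) as [c Hc].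
      apply is_series_Reals in Hc; revert Hc.
      apply is_series_ext; intros n; rewrite Ci_pow_even; unfold cos_n.
      rewrite Rsqr_pow2; simpl Re; as_R_eq; field; apply INR_fact_neq_0.
    + revert Z; apply is_pseries_ext; intros n.
      rewrite Cpow_add_r, Ci_pow_even; simpl; as_R_eq; ring.
  - apply is_series_ext with
      (fun n => / INR (fact n) * Im (Ci ^ n) * y ^ n)%R.
    { intros n; rewrite E; simpl; unfold Im; as_R_eq; ring. }
    apply is_pseries_R.
    unfold sin; destruct (exist_sin (Rsqr y)) as [c Hc].
    replace (y * c)%R with (0 + y * c)%R by ring.
    apply is_pseries_odd_even.
    + revert Z; apply is_pseries_ext; intros n; rewrite Ci_pow_even; simpl; as_R_eq; ring.
    + apply is_pseries_R; apply is_series_Reals in Hc; revert Hc.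
      apply is_series_ext; intros n.
      rewrite Cpow_add_r, Ci_pow_even; unfold sin_n.
      rewrite Rsqr_pow2; simpl Im; as_R_eq; field; apply INR_fact_neq_0.
Qed.

Lemma is_Cseries_Cexp (z : C) : is_Cseries (exp_term z) (Cexp z).
Proof.
  destruct z as [x y].
  replace (Cexp (x, y)) with (RtoC (exp x) * (cos y, sin y))
    by (apply injective_projections; unfold Cexp; simpl; ring).
  eapply is_Cseries_ext;
    [|apply is_Cseries_conv;
      [apply (exp_term_real x)|apply (exp_term_imag y)| |]];
    try apply ex_series_exp_term.
  intros n; rewrite conv_exp_term; f_equal.
  apply injective_projections; simpl; ring.
Qed.

(** The coefficients are kept explicit because the divided difference of [Cexp] at 0 must be known
    to take the value 1 there. *)
Lemma expands_Cexp :
  expands Cexp 0 (fun n => RtoC (/ INR (fact n))) 1 1.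
Proof.
  split; [lra|split].
  - intros n; rewrite pow1, Rmult_1_r, Cmod_R.
    assert (1 <= INR (fact n))%R
      by (change 1%R with (INR 1); apply le_INR, lt_O_fact).
    rewrite Rabs_pos_eq.
    + rewrite <- Rinv_1; apply Rinv_le_contravar; lra.
    + apply Rlt_le, Rinv_0_lt_compat; lra.
  - intros w _; rewrite Cplus_0_l; apply is_Cseries_Cexp.
Qed.

Lemma analytic_at_Cexp (z0 : C) : analytic_at Cexp z0.
Proof.
  apply analytic_at_intro with (fun n => Cexp z0 * RtoC (/ INR (fact n))) R1; [lra|].
  intros w _; rewrite Cexp_plus.
  apply is_Cseries_ext with (fun n => Cexp z0 * exp_term w n).
  - intros n; unfold exp_term; ring.
  - apply is_Cseries_scal, is_Cseries_Cexp.
Qed.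

Lemma Cexp_0 : Cexp 0 = 1.
Proof.
  unfold Cexp; simpl; rewrite exp_0, cos_0, sin_0.
  apply injective_projections; simpl; ring.
Qed.

(* With [phi u = (e^u - 1) / u] and [chi u = (phi u - 1) / u], both extended
   to [0], the function is [chi / phi]. *)
Lemma inv_one_minus_exp_regular_part :
  exists c, analytic_at
    (fun u => if Ceq_dec u 0 then c else / (1 - Cexp u) + / u) 0.
Proof.
  assert (Hphi := expands_divided_difference _ _ _ _ _ expands_Cexp).
  set (phi := fun z => if Ceq_dec z 0 then _ else _) in Hphi.
  assert (phi0 : phi 0 = 1).
  { unfold phi; destruct (Ceq_dec 0 0) as [_|n]; [|now elim n].
    simpl; now rewrite Rinv_1. }
  destruct (analytic_at_divided_difference _ _ Hphi) as [c Hchi].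
  exists c.
  assert (Hn : phi 0 <> 0) by (rewrite phi0; apply C1_nz).
  destruct (analytic_at_neq_0 _ _ Hphi Hn) as (d & Hd & Hphin).
  refine (analytic_at_ext _ _ _ d Hd _
            (analytic_at_mult _ _ _ Hchi (analytic_at_inv _ _ Hphi Hn))).
  intros w Hw; rewrite Cplus_0_l; specialize (Hphin w).
  replace (w - 0) with w in Hphin by ring; specialize (Hphin Hw).
  rewrite phi0.
  destruct (Ceq_dec w 0) as [->|E].
  - rewrite phi0; field; apply C1_nz.
  - revert Hphin; unfold phi; destruct (Ceq_dec w 0) as [|_]; [easy|].
    rewrite Cexp_0; replace (w - 0) with w by ring; intros Hphin.
    assert (Cexp w - 1 <> 0) by (intros K; apply Hphin; rewrite K; unfold Cdiv; ring).
    field; repeat split; trivial.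
    intros K; apply H; replace (Cexp w - 1) with (- (1 - Cexp w)) by ring.
    rewrite K; ring.
Qed.

Lemma Cexp_odd_PI (m : Z) : Cexp (Ci * RtoC (IZR (2 * m + 1) * PI)) = - (1).
Proof.
  (* Half of an odd multiple of [PI] is a zero of the cosine; the duplication formulas then give
     both components. *)
  assert (H : cos (IZR m * PI + PI / 2) = 0%R) by (apply cos_eq_0_1; now exists m).
  replace (Ci * RtoC (IZR (2 * m + 1) * PI))
    with ((0, 2 * (IZR m * PI + PI / 2))%R : C)
    by (rewrite (plus_IZR (2 * m)), (mult_IZR 2);
        apply injective_projections; simpl; field).
  unfold Cexp, Re, Im, fst, snd.
  rewrite exp_0, cos_2a_cos, sin_2a, H.
  apply injective_projections; simpl; ring.
Qed.

Lemma Cexp_eq_m1 (z : C) :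
  1 + Cexp z = 0 -> exists m : Z, z = Ci * RtoC (IZR (2 * m + 1) * PI).
Proof.
  destruct z as [x y]; unfold Cexp; simpl; intros E.
  assert (E1 := f_equal Re E); assert (E2 := f_equal Im E); simpl in E1, E2.
  assert (Hx := exp_pos x).
  assert (Hs : sin y = 0%R) by nra.
  assert (H2 := sin2_cos2 y); unfold Rsqr in H2.
  assert (Hcy : cos y = (-1)%R).
  { assert (P : ((cos y - 1) * (cos y + 1) = 0)%R) by nra.
    apply Rmult_integral in P; destruct P; nra. }
  assert (x = 0%R) as ->.
  { apply exp_inv; rewrite exp_0; rewrite Hcy in E1; lra. }
  (* By duplication, [cos y = -1] forces [cos (y / 2) = 0], and the zeros of the cosine are
     known. *)
  destruct (cos_eq_0_0 (y / 2)) as [m Hm].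
  { assert (D := cos_2a_cos (y / 2)).
    replace (2 * (y / 2))%R with y in D by field; nra. }
  exists m; rewrite (plus_IZR (2 * m)), (mult_IZR 2);
        apply injective_projections; simpl; lra.
Qed.

(** * Bernstein ellipses *)

Lemma cosh_sqr_sinh (a : R) : (cosh a * cosh a = 1 + sinh a * sinh a)%R.
Proof.
  unfold cosh, sinh; assert (H : (exp a * exp (- a) = 1)%R)
    by (rewrite <- exp_plus, Rplus_opp_r; apply exp_0).
  lra.
Qed.

Lemma cosh_pos (a : R) : (0 < cosh a)%R.
Proof. unfold cosh; generalize (exp_pos a) (exp_pos (- a)); lra. Qed.

Lemma cosh_ge_1 (a : R) : (1 <= cosh a)%R.
Proof. generalize (cosh_sqr_sinh a) (cosh_pos a); nra. Qed.

Lemma sinh_ge_0 (a : R) : (0 <= a)%R -> (0 <= sinh a)%R.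
Proof.
  intros [H| <-]; [|rewrite sinh_0; lra].
  apply sinh_lt in H; rewrite sinh_0 in H; lra.
Qed.

Lemma cosh_lt (a b : R) : (0 <= a < b)%R -> (cosh a < cosh b)%R.
Proof.
  intros [Ha Hab]; apply sinh_lt in Hab; apply sinh_ge_0 in Ha.
  generalize (cosh_sqr_sinh a) (cosh_sqr_sinh b) (cosh_pos a) (cosh_pos b); nra.
Qed.

Lemma cosh_inj (a b : R) :
  (0 <= a)%R -> (0 <= b)%R -> cosh a = cosh b -> a = b.
Proof.
  intros Ha Hb E; destruct (Rtotal_order a b) as [H|[H|H]]; trivial;
    [assert (cosh a < cosh b)%R | assert (cosh b < cosh a)%R];
    try apply cosh_lt; lra.
Qed.

Lemma cosh_surj (c : R) : (1 <= c)%R -> exists a, (0 <= a)%R /\ cosh a = c.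
Proof.
  intros Hc; exists (arcsinh (sqrt (c * c - 1))); split.
  - rewrite <- arcsinh_0; apply arcsinh_le, sqrt_pos.
  - generalize (cosh_sqr_sinh (arcsinh (sqrt (c * c - 1))))
      (cosh_pos (arcsinh (sqrt (c * c - 1)))).
    rewrite sinh_arcsinh, sqrt_sqrt by nra; nra.
Qed.

(* The Bernstein ellipse of parameter [alpha] is the set of points whose
   distances to the foci -1 and 1 add up to less than [2 * cosh alpha]. *)
Definition focal_sum (z : C) : R := (Cmod (z - 1) + Cmod (z + 1))%R.

Lemma Cmod_sqr (x y : R) : (Cmod (x, y) * Cmod (x, y) = x * x + y * y)%R.
Proof.
  unfold Cmod; rewrite sqrt_sqrt; simpl; nra.
Qed.

(** The two focal distances are exactly [cosh a - cos theta] and [cosh a + cos theta]: their squares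
    are perfect squares. The sign [e] treats both foci at once. *)
Lemma focal_sum_elliptic (a theta : R) :
  focal_sum (RtoC (cosh a * cos theta) + Ci * RtoC (sinh a * sin theta)) =
  (2 * cosh a)%R.
Proof.
  assert (Hc := cosh_ge_1 a); assert (Hs := cosh_sqr_sinh a).
  assert (Ht := COS_bound theta); assert (H1 := sin2_cos2 theta).
  unfold Rsqr in H1.
  assert (E : forall e : R, (e * e = 1)%R ->
    Cmod (RtoC (cosh a * cos theta) + Ci * RtoC (sinh a * sin theta) + RtoC e) =
    (cosh a + e * cos theta)%R).
  { intros e He.
    replace (RtoC (cosh a * cos theta) + Ci * RtoC (sinh a * sin theta) + RtoC e)
      with ((cosh a * cos theta + e, sinh a * sin theta)%R : C)
      by (apply injective_projections; simpl; ring).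
    assert (P : (0 <= cosh a + e * cos theta)%R).
    { assert (K : ((e - 1) * (e + 1) = 0)%R) by lra.
      apply Rmult_integral in K; destruct K; [replace e with 1%R by lra|
        replace e with (-1)%R by lra]; lra. }
    rewrite <- (sqrt_square _ P); unfold Cmod; f_equal; simpl.
    replace ((cosh a * cos theta + e) * ((cosh a * cos theta + e) * 1) +
             sinh a * sin theta * (sinh a * sin theta * 1))%R
      with (cosh a * cosh a * (cos theta * cos theta) + 2 * e * cosh a * cos theta +
            e * e + (sinh a * sinh a) * (sin theta * sin theta))%R by ring.
    replace (sinh a * sinh a)%R with (cosh a * cosh a - 1)%R by lra.
    replace (sin theta * sin theta)%R with (1 - cos theta * cos theta)%R by lra.
    replace ((cosh a + e * cos theta) * (cosh a + e * cos theta))%R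
      with (cosh a * cosh a + 2 * e * cosh a * cos theta +
            (e * e) * (cos theta * cos theta))%R by ring.
    rewrite He; ring. }
  unfold focal_sum, Cminus; rewrite <- RtoC_opp, !E by ring; ring.
Qed.

Lemma Cmod_triangle_sub (z w : C) : (Cmod z <= Cmod w + Cmod (z - w))%R.
Proof.
  replace z with (w + (z - w)) at 1 by ring; apply Cmod_triangle.
Qed.

(** Half the sum [c] and half the difference [u] of the focal distances serve as [cosh a] and
    [cos theta]; the triangle inequality gives [1 <= c] and [-1 <= u <= 1]. The sign of [y] then
    selects [acos u] or its reflection. *)
Lemma elliptic_coordinates (z : C) :
  exists a theta, (0 <= a)%R /\ (0 <= theta < 2 * PI)%R /\
    z = RtoC (cosh a * cos theta) + Ci * RtoC (sinh a * sin theta).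
Proof.
  destruct z as [x y].
  set (p := Cmod ((x, y) + 1)); set (q := Cmod ((x, y) - 1)).
  assert (Hp : (p * p = (x + 1) * (x + 1) + y * y)%R).
  { unfold p; replace ((x, y) + 1) with ((x + 1, y)%R : C)
      by (apply injective_projections; simpl; ring).
    apply Cmod_sqr. }
  assert (Hq : (q * q = (x - 1) * (x - 1) + y * y)%R).
  { unfold q; replace ((x, y) - 1) with ((x - 1, y)%R : C)
      by (apply injective_projections; simpl; ring).
    apply Cmod_sqr. }
  assert (p0 : (0 <= p)%R) by apply Cmod_ge_0.
  assert (q0 : (0 <= q)%R) by apply Cmod_ge_0.
  assert (E2 : Cmod 2 = 2%R) by (rewrite Cmod_R; apply Rabs_pos_eq; lra).
  assert (T1 : (p <= q + 2)%R).
  { generalize (Cmod_triangle_sub ((x, y) + 1) ((x, y) - 1)); fold p q.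
    replace ((x, y) + 1 - ((x, y) - 1)) with (RtoC 2) by ring; now rewrite E2. }
  assert (T2 : (q <= p + 2)%R).
  { generalize (Cmod_triangle_sub ((x, y) - 1) ((x, y) + 1)); fold p q.
    replace ((x, y) - 1 - ((x, y) + 1)) with (- RtoC 2) by ring.
    now rewrite Cmod_opp, E2. }
  assert (T3 : (2 <= p + q)%R).
  { rewrite <- E2; replace (RtoC 2) with ((x, y) + 1 + - ((x, y) - 1)) by ring.
    eapply Rle_trans; [apply Cmod_triangle|]; rewrite Cmod_opp; apply Rle_refl. }
  set (c := ((p + q) / 2)%R); set (u := ((p - q) / 2)%R).
  assert (Hx : x = (c * u)%R) by (unfold c, u; nra).
  assert (Hc : (1 <= c)%R) by (unfold c; lra).
  assert (Hu : (-1 <= u <= 1)%R) by (unfold u; lra).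
  assert (Hy : (y * y = (c * c - 1) * (1 - u * u))%R).
  { assert (p = c + u)%R by (unfold c, u; field).
    rewrite H, Hx in Hp; lra. }
  destruct (cosh_surj c Hc) as (a & Ha & Hca).
  assert (Hsa := cosh_sqr_sinh a); rewrite Hca in Hsa.
  assert (Hs0 := sinh_ge_0 a Ha).
  assert (Ht := acos_bound u).
  assert (Hcos := cos_acos u Hu).
  assert (Hsin : (0 <= sin (acos u))%R) by (apply sin_ge_0; lra).
  assert (Hsc := sin2_cos2 (acos u)); rewrite Hcos in Hsc; unfold Rsqr in Hsc.
  assert (Hyy : (y * y = (sinh a * sin (acos u)) * (sinh a * sin (acos u)))%R).
  { replace ((sinh a * sin (acos u)) * (sinh a * sin (acos u)))%R
      with ((sinh a * sinh a) * (sin (acos u) * sin (acos u)))%R by ring.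
    rewrite Hy; f_equal; lra. }
  assert (Hpr : (0 <= sinh a * sin (acos u))%R) by now apply Rmult_le_pos.
  assert (HPI := PI_RGT_0).
  exists a; destruct (Rle_lt_dec 0 y) as [y0|y0].
  - exists (acos u); split; [trivial|split; [lra|]].
    rewrite Hca, Hcos; apply injective_projections; simpl; [lra|].
    replace y with (sinh a * sin (acos u))%R by nra; ring.
  - exists (- acos u + 2 * PI)%R; split; [trivial|split].
    + split; [lra|].
      (* The angle [2 * PI] itself is not allowed; it would require [acos u = 0] and hence
         [y = 0]. *)
      destruct (Rle_lt_or_eq_dec 0 (acos u)) as [|K]; [lra|lra|].
      rewrite <- K, sin_0 in Hyy; nra.
    + rewrite <- (cos_neg (acos u)) in Hcos.
      assert (P1 := cos_period (- acos u) 1); assert (P2 := sin_period (- acos u) 1).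
      simpl INR in P1, P2; rewrite Rmult_1_r in P1, P2.
      rewrite P1, P2, Hca, Hcos, sin_neg.
      apply injective_projections; simpl; [lra|].
      replace y with (- (sinh a * sin (acos u)))%R by nra; ring.
Qed.

(** By elliptic coordinates and the monotonicity of [cosh]. For [alpha = 0] both sides are false,
    since focal sums are at least 2. *)
Lemma bernstein_focal_sum (alpha : R) (z : C) :
  (0 <= alpha)%R -> bernstein alpha z <-> (focal_sum z < 2 * cosh alpha)%R.
Proof.
  intros H0; split.
  - intros (a & theta & Ha & _ & ->); rewrite focal_sum_elliptic.
    generalize (cosh_lt _ _ Ha); lra.
  - destruct (elliptic_coordinates z) as (a & theta & Ha & Ht & ->).
    rewrite focal_sum_elliptic; intros H; exists a, theta; repeat split; try tauto.
    destruct (Rlt_le_dec a alpha) as [|[K|K]]; trivial.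
    + generalize (cosh_lt alpha a (conj H0 K)); lra.
    + rewrite K in H; lra.
Qed.

Lemma focal_sum_Lipschitz (z w : C) :
  (focal_sum z <= focal_sum w + 2 * Cmod (w - z))%R.
Proof.
  unfold focal_sum.
  generalize (Cmod_triangle_sub (z - 1) (w - 1)) (Cmod_triangle_sub (z + 1) (w + 1)).
  replace (z - 1 - (w - 1)) with (- (w - z)) by ring.
  replace (z + 1 - (w + 1)) with (- (w - z)) by ring.
  rewrite Cmod_opp; lra.
Qed.

(** The focal sum is continuous, so a strict inequality either way would put a whole disc around [x]
    inside or outside the ellipse. *)
Lemma bernstein_param_focal_sum (x : C) (alpha : R) :
  is_bernstein_param x alpha -> focal_sum x = (2 * cosh alpha)%R.
Proof.
  intros (H0 & H1 & H2); apply Rle_antisym; apply Rnot_lt_le; intros K.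
  - assert (He : (0 < (focal_sum x - 2 * cosh alpha) / 2)%R) by lra.
    destruct (H1 (mkposreal _ He)) as (w & Hw & Sw); simpl in Hw.
    apply bernstein_focal_sum in Sw; trivial.
    generalize (focal_sum_Lipschitz x w); lra.
  - assert (He : (0 < (2 * cosh alpha - focal_sum x) / 2)%R) by lra.
    destruct (H2 (mkposreal _ He)) as (w & Hw & Sw); simpl in Hw.
    apply Sw, bernstein_focal_sum; trivial.
    generalize (focal_sum_Lipschitz w x).
    replace (x - w) with (- (w - x)) by ring; rewrite Cmod_opp; lra.
Qed.

(** Convexity: the origin has focal sum 2, so moving from [x] towards it lowers the focal sum. *)
Lemma focal_sum_scale (t : R) (x : C) :
  (0 < t < 1)%R -> (2 < focal_sum x)%R ->
  (focal_sum (RtoC (1 - t) * x) < focal_sum x)%R.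
Proof.
  intros Ht Hx.
  assert (E : forall e : R, Rabs e = 1%R ->
    (Cmod (RtoC (1 - t) * x + RtoC e) <= (1 - t) * Cmod (x + RtoC e) + t)%R).
  { intros e He.
    replace (RtoC (1 - t) * x + RtoC e)
      with (RtoC (1 - t) * (x + RtoC e) + RtoC t * RtoC e)
      by (rewrite RtoC_minus; ring).
    eapply Rle_trans; [apply Cmod_triangle|].
    rewrite !Cmod_mult, !Cmod_R, He, !Rabs_pos_eq by lra.
    rewrite Rmult_1_r; apply Rle_refl. }
  assert (E1 := E 1%R Rabs_R1).
  assert (E2 := E (Ropp 1) (eq_trans (Rabs_Ropp 1) Rabs_R1)).
  rewrite RtoC_opp in E2.
  assert (0 < t * (focal_sum x - 2))%R by (apply Rmult_lt_0_compat; lra).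
  unfold focal_sum, Cminus in *; lra.
Qed.

(** Scaling approaches [x] from inside, and [x] itself lies outside the open region. The segment
    between the foci must be excluded: there [alpha = 0], and the empty region has no boundary. *)
Lemma focal_sum_bernstein_param (x : C) (alpha : R) :
  (0 <= alpha)%R -> (2 < focal_sum x)%R -> focal_sum x = (2 * cosh alpha)%R ->
  is_bernstein_param x alpha.
Proof.
  intros H0 Hx E; split; [trivial|split].
  - intros [eps Heps]; simpl.
    assert (Hm := Cmod_ge_0 x).
    (* This choice ensures both [t < 1] and [t * Cmod x < eps]. *)
    set (t := (eps / (eps + Cmod x + 1))%R).
    assert (Hd : (t * (eps + Cmod x + 1) = eps)%R) by (unfold t; field; lra).
    assert (Ht : (0 < t)%R) by (apply Rdiv_lt_0_compat; lra).
    exists (RtoC (1 - t) * x); split.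
    + replace (RtoC (1 - t) * x - x) with (- (RtoC t * x))
        by (rewrite RtoC_minus; ring).
      rewrite Cmod_opp, Cmod_mult, Cmod_R, Rabs_pos_eq; nra.
    + apply bernstein_focal_sum; trivial.
      rewrite <- E; apply focal_sum_scale; trivial; nra.
  - intros [eps Heps]; exists x; split; simpl.
    + replace (x - x) with (RtoC 0) by ring; now rewrite Cmod_0.
    + rewrite bernstein_focal_sum by trivial; lra.
Qed.

Lemma focal_sum_pair (x y : R) :
  focal_sum (x, y) = (sqrt ((x - 1) ^ 2 + y ^ 2) + sqrt ((x + 1) ^ 2 + y ^ 2))%R.
Proof.
  unfold focal_sum, Cmod; simpl.
  f_equal; f_equal; ring.
Qed.

(** All poles lie on the vertical line through [EF], so this reduces comparisons of their ellipses
    to comparisons of odd integers. *)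
Lemma focal_sum_lt_Im (x y1 y2 : R) :
  (y1 ^ 2 < y2 ^ 2)%R <-> (focal_sum (x, y1) < focal_sum (x, y2))%R.
Proof.
  rewrite !focal_sum_pair; split; intros H.
  - apply Rplus_lt_compat; apply sqrt_lt_1_alt;
      (split; [apply Rplus_le_le_0_compat; apply pow2_ge_0|lra]).
  - apply Rnot_le_lt; intros K; apply (Rlt_not_le _ _ H).
    apply Rplus_le_compat; apply sqrt_le_1_alt; lra.
Qed.

Lemma focal_sum_ge_2 (z : C) : (2 <= focal_sum z)%R.
Proof.
  destruct (elliptic_coordinates z) as (a & theta & _ & _ & ->).
  rewrite focal_sum_elliptic; generalize (cosh_ge_1 a); lra.
Qed.

Lemma fermi_pole_pair (beta EF : R) (l : Z) :
  beta <> 0%R -> fermi_pole beta EF l = (EF, IZR l * PI / beta)%R.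
Proof.
  intros Hb; unfold fermi_pole, Cdiv; rewrite <- RtoC_inv by trivial.
  apply injective_projections; simpl; field; trivial.
Qed.

(** The two conjugate poles have the same focal sum, so one parameter fits both; injectivity of
    [cosh] makes it unique, as [iota] requires. *)
Lemma alpha_fermi_spec (k : nat) (beta EF : R) :
  (0 < beta)%R ->
  (0 <= alpha_fermi k beta EF)%R /\
  focal_sum (fermi_pole beta EF (2 * Z.of_nat k + 1)) =
  (2 * cosh (alpha_fermi k beta EF))%R.
Proof.
  intros Hb; set (l := (2 * Z.of_nat k + 1)%Z).
  assert (Hl : focal_sum (fermi_pole beta EF (- l)) = focal_sum (fermi_pole beta EF l)).
  { rewrite !fermi_pole_pair, !focal_sum_pair, opp_IZR by lra.
    f_equal; f_equal; field; lra. }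
  (* The pole is compared with the real point [EF] below or above it, whose focal sum is at least
     2. *)
  assert (H2 : (2 < focal_sum (fermi_pole beta EF l))%R).
  { eapply Rle_lt_trans; [apply (focal_sum_ge_2 (EF, 0%R))|].
    rewrite fermi_pole_pair by lra; apply focal_sum_lt_Im.
    rewrite pow_i by lia; apply pow2_gt_0.
    assert (0 < IZR l)%R by (apply IZR_lt; lia).
    generalize PI_RGT_0; intros.
    apply Rgt_not_eq, Rdiv_lt_0_compat; [|trivial].
    now apply Rmult_lt_0_compat. }
  destruct (cosh_surj (focal_sum (fermi_pole beta EF l) / 2)) as (a & Ha & Ea);
    [lra|].
  assert (E : alpha_fermi k beta EF = a).
  { apply (@iota_unique R_AbsRing R_CompleteNormedModule).
    - intros b [Hb1 _]; apply cosh_inj; [apply Hb1|trivial|].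
      apply bernstein_param_focal_sum in Hb1; fold l in Hb1; lra.
    - split; apply focal_sum_bernstein_param; fold l; lra. }
  rewrite E; split; [trivial|lra].
Qed.

Lemma alpha_fermi_mono (k : nat) (beta EF : R) (z : C) :
  (0 < beta)%R -> bernstein (alpha_fermi 0 beta EF) z ->
  bernstein (alpha_fermi k beta EF) z.
Proof.
  intros Hb.
  destruct (alpha_fermi_spec 0 beta EF Hb) as [H0 E0].
  destruct (alpha_fermi_spec k beta EF Hb) as [Hk Ek].
  rewrite !bernstein_focal_sum by trivial.
  rewrite <- Ek, <- E0, !fermi_pole_pair by lra; intros H.
  apply (Rlt_le_trans _ _ _ H), Rnot_lt_le; intros K.
  apply focal_sum_lt_Im in K; revert K; apply Rle_not_lt.
  apply pow_incr; split.
  - apply Rdiv_le_0_compat; [|trivial].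
    apply Rmult_le_pos; [apply IZR_le; lia|apply Rlt_le, PI_RGT_0].
  - apply Rmult_le_compat_r; [now apply Rlt_le, Rinv_0_lt_compat|].
    apply Rmult_le_compat_r; [apply Rlt_le, PI_RGT_0|apply IZR_le; lia].
Qed.

Lemma fermi_pole_in_Zk (k : nat) (beta EF : R) (m : Z) :
  (0 < beta)%R ->
  bernstein (alpha_fermi k beta EF) (fermi_pole beta EF (2 * m + 1)) ->
  In (fermi_pole beta EF (2 * m + 1)) (Zk k beta EF).
Proof.
  intros Hb; destruct (alpha_fermi_spec k beta EF Hb) as [Hk Ek].
  rewrite bernstein_focal_sum, <- Ek, !fermi_pole_pair by (trivial || lra).
  rewrite <- focal_sum_lt_Im; intros H.
  assert (HPI := PI_RGT_0).
  assert (Hi := Rinv_0_lt_compat _ Hb).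
  assert (Hsq : ((2 * m + 1) * (2 * m + 1) <
                 (2 * Z.of_nat k + 1) * (2 * Z.of_nat k + 1))%Z).
  { apply lt_IZR; rewrite !mult_IZR.
    apply Rmult_lt_reg_r with ((PI / beta) * (PI / beta))%R.
    - now apply Rmult_lt_0_compat; apply Rmult_lt_0_compat.
    - unfold Rdiv in *; lra. }
  rewrite <- fermi_pole_pair by lra.
  (* Solving [2 * m + 1 = - 2 * k + 1 + 2 * j] gives [j = m + k], and [Hsq] places it between 0 and
     [2 * k - 1]. *)
  unfold Zk; apply in_map_iff; exists (Z.to_nat (m + Z.of_nat k)); split.
  - f_equal; nia.
  - apply in_seq; nia.
Qed.

(** * Divided differences *)

Lemma Cinv_0 : / 0 = (0 : C).
Proof. apply injective_projections; simpl; unfold Rdiv; ring. Qed.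

(** Punctured neighbourhoods are nonempty, which makes limits along them unique and lets [iota] be
    evaluated. *)
Lemma locally'_C_proper (z0 : C) : ProperFilter' (@locally' C_UniformSpace z0).
Proof.
  split; [|apply locally'_filter].
  intros [d H]; apply (H (fst z0 + d / 2, snd z0)%R).
  - assert (Hd := cond_pos d); split; simpl.
    + change (Rabs (fst z0 + d / 2 - fst z0) < d)%R.
      replace (fst z0 + d / 2 - fst z0)%R with (d / 2)%R by ring.
      rewrite Rabs_pos_eq; lra.
    + apply ball_center.
  - assert (Hd := cond_pos d).
    intros E; apply (f_equal fst) in E; simpl in E; lra.
Qed.

Lemma filterlim_punctured_analytic (f g : C -> C) (z0 : C) (d : R) :
  analytic_at g z0 -> (0 < d)%R ->
  (forall z, (Cmod (z - z0) < d)%R -> z <> z0 -> f z = g z) ->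
  filterlim f (@locally' C_UniformSpace z0) (@locally C_UniformSpace (g z0)).
Proof.
  intros Hg Hd E; destruct (analytic_at_Lipschitz _ _ Hg) as (L & d' & HL & Hd' & H).
  apply filterlim_locally; intros [eps Heps].
  set (r := (Rmin d (Rmin d' (eps / L)))%R).
  assert (Hr : (0 < r)%R) by (repeat apply Rmin_pos; trivial; now apply Rdiv_lt_0_compat).
  (* Balls of the product structure are squares; half the side keeps the sum of the two coordinate
     distances, and with it the modulus, below [r]. *)
  assert (Hr2 : (0 < r / 2)%R) by lra.
  exists (mkposreal _ Hr2); intros z [B1 B2] Hz; simpl in B1, B2.
  change (Rabs (fst z - fst z0) < r / 2)%R in B1.
  change (Rabs (snd z - snd z0) < r / 2)%R in B2.
  assert (B : (Cmod (z - z0) < r)%R).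
  { eapply Rle_lt_trans; [apply Cmod_le_Re_Im|].
    unfold Re, Im; simpl; unfold Rminus in *; lra. }
  assert (R1 := Rlt_le_trans _ _ _ B (Rmin_l _ _)).
  assert (R23 := Rlt_le_trans _ _ _ B (Rmin_r _ _)).
  assert (R2 := Rlt_le_trans _ _ _ R23 (Rmin_l _ _)).
  assert (R3 := Rlt_le_trans _ _ _ R23 (Rmin_r _ _)).
  rewrite (E z R1 Hz); specialize (H z R2).
  apply Rmult_lt_compat_r with (r := L) in R3; [|trivial].
  unfold Rdiv in R3; rewrite Rmult_assoc, Rinv_l in R3 by lra.
  assert (K : (Cmod (g z - g z0) < eps)%R) by lra.
  split; simpl.
  - change (Rabs (Re (g z - g z0)) < eps)%R.
    eapply Rle_lt_trans; [apply re_le_Cmod|trivial].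
  - change (Rabs (Im (g z - g z0)) < eps)%R.
    eapply Rle_lt_trans; [apply im_le_Cmod|trivial].
Qed.

Lemma iota_punctured_analytic (f g : C -> C) (z0 : C) (d : R) :
  analytic_at g z0 -> (0 < d)%R ->
  (forall z, (Cmod (z - z0) < d)%R -> z <> z0 -> f z = g z) ->
  iota (fun l : C_CompleteNormedModule =>
          filterlim f (@locally' C_UniformSpace z0) (locally l)) = g z0.
Proof.
  intros Hg Hd E.
  apply (@iota_filterlim_locally C_AbsRing C_CompleteNormedModule _ _
           (locally'_C_proper z0)).
  now apply filterlim_punctured_analytic with d.
Qed.

(** A limit on the diagonal, rather than a supplied constant, makes one function of two variables
    serve all base points. *)
Definition divided_difference (f : C -> C) (z1 z2 : C) : C :=
  if Ceq_dec z1 z2 then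
    iota (fun l : C_CompleteNormedModule =>
            filterlim (fun z => (f z - f z2) / (z - z2))
              (@locally' C_UniformSpace z2) (locally l))
  else (f z1 - f z2) / (z1 - z2).

Lemma divided_difference_sym (f : C -> C) (z1 z2 : C) :
  divided_difference f z1 z2 = divided_difference f z2 z1.
Proof.
  destruct (Ceq_dec z1 z2) as [->|H]; [reflexivity|]; unfold divided_difference.
  destruct (Ceq_dec z1 z2), (Ceq_dec z2 z1) as [E|E]; try easy; [now elim H|].
  field; split; now apply Cminus_eq_contra.
Qed.

(** With the second argument frozen, [f z2] is a constant. Away from [z2] the quotient has a
    nonvanishing denominator; at [z2] the [iota] returns the constant that fills the removable
    singularity. *)
Lemma analytic_at_divided_difference_l (f : C -> C) (z1 z2 : C) :
  analytic_at f z1 -> analytic_at (fun z => divided_difference f z z2) z1.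
Proof.
  intros Hf; destruct (Ceq_dec z1 z2) as [<-|Hn].
  - destruct (analytic_at_divided_difference _ _ Hf) as [c Hc].
    assert (E := iota_punctured_analytic
                   (fun z => (f z - f z1) / (z - z1)) _ _ R1 Hc Rlt_0_1).
    revert Hc; apply analytic_at_ext with R1; [lra|]; intros w _.
    unfold divided_difference; destruct (Ceq_dec (z1 + w) z1); [|trivial].
    rewrite E.
    + destruct (Ceq_dec z1 z1); [trivial|easy].
    + intros z _ Hz; destruct (Ceq_dec z z1); [easy|trivial].
  - assert (Hn' := Cminus_eq_contra _ _ Hn).
    assert (Hm := proj1 (Cmod_gt_0 _) Hn').
    apply analytic_at_ext with (fun z => (f z - f z2) * / (z - z2)) (Cmod (z1 - z2)).
    + trivial.
    + intros w Hw; unfold divided_difference.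
      destruct (Ceq_dec (z1 + w) z2) as [E|_]; [|reflexivity].
      exfalso; revert Hw; rewrite <- E.
      replace (z1 - (z1 + w)) with (- w) by ring; rewrite Cmod_opp; lra.
    + apply analytic_at_mult.
      * apply analytic_at_minus; [trivial|apply analytic_at_const].
      * apply analytic_at_inv; [|trivial].
        apply analytic_at_minus; [apply analytic_at_id|apply analytic_at_const].
Qed.

Lemma analytic2_on_divided_difference (U : C -> Prop) (f : C -> C) :
  (forall z, U z -> analytic_at f z) -> analytic2_on U (divided_difference f).
Proof.
  intros H z1 z2 H1 H2; split.
  - now apply analytic_at_divided_difference_l, H.
  - apply analytic_at_ext with (fun z => divided_difference f z z1) R1; [lra| |].
    + intros w _; apply divided_difference_sym.
    + now apply analytic_at_divided_difference_l, H.
Qed.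

(** * Principal parts of the Fermi function *)

Lemma list_isolated (s : list C) (z0 : C) :
  exists d, (0 < d)%R /\
    forall z, (Cmod (z - z0) < d)%R -> In z s -> z = z0.
Proof.
  induction s as [|x s (d & Hd & IH)].
  - exists R1; split; [lra|easy].
  - destruct (Ceq_dec x z0) as [->|Hx].
    + exists d; split; trivial; intros z Hz [<-|Hi]; auto.
    + assert (Hm := proj1 (Cmod_gt_0 _) (Cminus_eq_contra _ _ Hx)).
      exists (Rmin d (Cmod (x - z0))); split; [now apply Rmin_pos|].
      intros z Hz [<-|Hi].
      * generalize (Rmin_r d (Cmod (x - z0))); lra.
      * apply IH; trivial; generalize (Rmin_l d (Cmod (x - z0))); lra.
Qed.

Lemma Csum_ext (s : list C) (f g : C -> C) :
  (forall x, In x s -> f x = g x) -> Csum s f = Csum s g.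
Proof.
  intros H; unfold Csum; f_equal; now apply map_ext_in.
Qed.

Lemma Csum_cons (x : C) (s : list C) (g : C -> C) :
  Csum (x :: s) g = g x + Csum s g.
Proof. reflexivity. Qed.

(** The term of [p] is zeroed rather than deleted, so the rest is a sum over the same list and
    matches [fermi_regular] at [p], where that term is a multiple of [/ 0]. *)
Lemma Csum_split (s : list C) (p : C) (g : C -> C) :
  NoDup s -> In p s ->
  Csum s g = g p + Csum s (fun x => if Ceq_dec x p then 0 else g x).
Proof.
  induction 1 as [|x s Hx Hs IH]; [easy|]; intros Hp; rewrite !Csum_cons.
  destruct (Ceq_dec x p) as [->|Hn].
  - rewrite Cplus_0_l; f_equal; apply Csum_ext; intros y Hy.
    destruct (Ceq_dec y p) as [->|]; [easy|trivial].
  - destruct Hp as [->|Hp]; [easy|]; rewrite (IH Hp); ring.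
Qed.

Lemma NoDup_Zk (k : nat) (beta EF : R) : (0 < beta)%R -> NoDup (Zk k beta EF).
Proof.
  intros Hb; unfold Zk; apply NoDup_map_NoDup_ForallPairs; [|apply seq_NoDup].
  intros i j _ _ E; rewrite !fermi_pole_pair in E by lra.
  apply (f_equal snd) in E; unfold snd in E.
  apply Rmult_eq_reg_r in E; [|now apply Rinv_neq_0_compat, Rgt_not_eq].
  apply Rmult_eq_reg_r in E; [|apply PI_neq0].
  apply eq_IZR in E; lia.
Qed.

(** Shifting by an odd multiple of [PI * Ci] changes the sign of the exponential, so the local form
    is the same at every pole. *)
Lemma fermi_at_pole (beta EF : R) (m : Z) (z : C) :
  beta <> 0%R ->
  fermi beta (z - EF) =
  / (1 - Cexp (beta * (z - fermi_pole beta EF (2 * m + 1)))).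
Proof.
  intros Hb; unfold fermi; f_equal.
  set (p := fermi_pole beta EF (2 * m + 1)).
  replace (beta * (z - EF))
    with (beta * (z - p) + Ci * RtoC (IZR (2 * m + 1) * PI)).
  - rewrite Cexp_plus, Cexp_odd_PI; ring.
  - unfold p, fermi_pole; rewrite RtoC_mult; field.
    intros E; apply RtoC_inj in E; auto.
Qed.

Lemma Zk_odd (k : nat) (beta EF : R) (p : C) :
  In p (Zk k beta EF) -> exists m, p = fermi_pole beta EF (2 * m + 1).
Proof.
  unfold Zk; rewrite in_map_iff; intros (j & <- & _).
  exists (Z.of_nat j - Z.of_nat k)%Z; f_equal; lia.
Qed.

(* The Fermi function minus its principal parts, whose residues are [- / beta].
   At a pole [z] in [Zk] the term of [z] itself is [/ 0 = 0] and drops out, so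
   that [c] is the constant term of the regular part there; it is the same at
   all poles by periodicity. *)
Definition fermi_regular (k : nat) (beta EF : R) (c z : C) : C :=
  (if in_dec Ceq_dec z (Zk k beta EF) then c else fermi beta (z - EF)) +
  Csum (Zk k beta EF) (fun p => / beta * / (z - p)).

Lemma analytic_at_simple_pole (b p z0 : C) :
  z0 <> p -> analytic_at (fun z => b * / (z - p)) z0.
Proof.
  intros H; apply analytic_at_mult; [apply analytic_at_const|].
  apply analytic_at_inv; [|now apply Cminus_eq_contra].
  apply analytic_at_minus; [apply analytic_at_id|apply analytic_at_const].
Qed.

(** At a point of [Zk], its own principal part combines with the Fermi function into the regular
    part in [u = beta * (z - z0)], and the other terms are analytic. Elsewhere in the ellipse the
    Fermi denominator does not vanish. *)
Lemma analytic_at_fermi_regular (k : nat) (beta EF : R) (c z0 : C) :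
  (0 < beta)%R ->
  analytic_at (fun u => if Ceq_dec u 0 then c else / (1 - Cexp u) + / u) 0 ->
  bernstein (alpha_fermi k beta EF) z0 ->
  analytic_at (fermi_regular k beta EF c) z0.
Proof.
  intros Hb Hq HU.
  assert (Hb' : RtoC beta <> 0) by (intros E; apply RtoC_inj in E; lra).
  destruct (list_isolated (Zk k beta EF) z0) as (d & Hd & Hiso).
  assert (Hiso' : forall w, (Cmod w < d)%R -> In (z0 + w) (Zk k beta EF) -> w = 0).
  { intros w Hw Hi; apply Hiso in Hi.
    - replace w with (z0 + w - z0) by ring; rewrite Hi; ring.
    - now replace (z0 + w - z0) with w by ring. }
  destruct (in_dec Ceq_dec z0 (Zk k beta EF)) as [Hin|Hin].
  - destruct (Zk_odd _ _ _ _ Hin) as [m Hm].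
    apply analytic_at_ext with
      (fun z =>
         (fun u => if Ceq_dec u 0 then c else / (1 - Cexp u) + / u)
           (beta * (z - z0)) +
         Csum (Zk k beta EF)
           (fun p => if Ceq_dec p z0 then 0 else / beta * / (z - p))) d;
      [trivial| |].
    + intros w Hw; cbv beta; unfold fermi_regular.
      replace (z0 + w - z0) with w by ring.
      destruct (Ceq_dec w 0) as [->|Hn].
      * rewrite Cplus_0_r.
        destruct (in_dec Ceq_dec z0 (Zk k beta EF)) as [_|]; [|easy].
        destruct (Ceq_dec (beta * 0) 0) as [_|K]; [|elim K; ring].
        f_equal; apply Csum_ext; intros p _.
        destruct (Ceq_dec p z0) as [->|]; [|trivial].
        replace (z0 - z0) with (RtoC 0) by ring; rewrite Cinv_0; ring.
      * destruct (in_dec Ceq_dec (z0 + w) (Zk k beta EF)) as [K|_];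
          [now elim Hn; apply Hiso'|].
        destruct (Ceq_dec (beta * w) 0) as [K|_];
          [now apply (Cmult_neq_0 _ _ Hb' Hn) in K|].
        rewrite (Csum_split _ z0 (fun p => / beta * / (z0 + w - p))
                   (NoDup_Zk k beta EF Hb) Hin).
        rewrite (fermi_at_pole beta EF m) by lra; rewrite <- Hm; cbv beta.
        replace (z0 + w - z0) with w by ring.
        (* The [/ u] of the local expansion is precisely the term of [z0] in the sum; this is the
           residue computation. *)
        replace (/ (beta * w)) with (/ beta * / w) by (field; auto).
        ring.
    + apply analytic_at_plus.
      * apply (analytic_at_affine
                 (fun u => if Ceq_dec u 0 then c else / (1 - Cexp u) + / u)).
        now replace (beta * (z0 - z0)) with (RtoC 0) by ring.
      * apply analytic_at_Csum; intros p Hp.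
        destruct (Ceq_dec p z0); [apply analytic_at_const|].
        now apply analytic_at_simple_pole, not_eq_sym.
  - apply analytic_at_ext with
      (fun z => / (1 + Cexp (beta * (z - EF))) +
                Csum (Zk k beta EF) (fun p => / beta * / (z - p))) d; [trivial| |].
    + intros w Hw; unfold fermi_regular.
      destruct (in_dec Ceq_dec (z0 + w) (Zk k beta EF)) as [K|_]; [|reflexivity].
      elim Hin; apply Hiso' in Hw as E; trivial; now rewrite E, Cplus_0_r in K.
    + apply analytic_at_plus.
      * apply analytic_at_inv.
        -- apply analytic_at_plus; [apply analytic_at_const|].
           apply analytic_at_affine, analytic_at_Cexp.
        (* Here the ellipse enters: a zero of the denominator is an odd pole inside it, hence listed
           in [Zk]. *)
        -- intros E; apply Cexp_eq_m1 in E; destruct E as [m Hm].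
           assert (Ez : z0 = fermi_pole beta EF (2 * m + 1)).
           { replace z0 with (EF + beta * (z0 - EF) / beta) by (field; auto).
             unfold fermi_pole; rewrite Hm, RtoC_mult; field; auto. }
           apply Hin; rewrite Ez in HU |- *; now apply fermi_pole_in_Zk.
      * apply analytic_at_Csum; intros p Hp; apply analytic_at_simple_pole.
        now intros ->.
Qed.

(** Partial fractions, term by term. The order [E2] before [E1] on the right reflects the negative
    sign of the residues. *)
Lemma Csum_resolvent (s : list C) (b E1 E2 : C) :
  E1 <> E2 -> ~ In E1 s -> ~ In E2 s ->
  Csum s (fun z => b * / ((E1 - z) * (E2 - z))) =
  (Csum s (fun z => b * / (E2 - z)) - Csum s (fun z => b * / (E1 - z))) / (E1 - E2).
Proof.
  intros Hn; apply Cminus_eq_contra in Hn.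
  induction s as [|x s IH]; intros H1 H2.
  - unfold Csum; simpl; now field.
  - rewrite !Csum_cons, IH by (intros K; (apply H1 + apply H2); now right).
    field; repeat split; trivial; apply Cminus_eq_contra; intros ->;
      (apply H1 + apply H2); now left.
Qed.

Lemma F_off_diag_decomposition (k : nat) (beta eta omega EF : R) (c E1 E2 : C) :
  E1 <> E2 -> ~ In E1 (Zk k beta EF) -> ~ In E2 (Zk k beta EF) ->
  E1 - E2 + omega + Ci * eta <> 0 ->
  F_off_diag beta eta omega EF E1 E2 =
    / (E1 - E2 + omega + Ci * eta) *
    (Csum (Zk k beta EF) (fun z => / beta * / ((E1 - z) * (E2 - z))) +
     divided_difference (fermi_regular k beta EF c) E1 E2).
Proof.
  intros Hn H1 H2 HD; unfold F_off_diag, divided_difference, fermi_regular.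
  rewrite Csum_resolvent by trivial.
  destruct (Ceq_dec E1 E2) as [|_]; [easy|].
  destruct (in_dec Ceq_dec E1 (Zk k beta EF)) as [|_]; [easy|].
  destruct (in_dec Ceq_dec E2 (Zk k beta EF)) as [|_]; [easy|].
  field; split; [now apply Cminus_eq_contra|trivial].
Qed.

(** [Rk] is chosen before [eta] and [omega], so it depends on [k], [beta] and [EF] alone. The
    excluded arguments are those where a displayed denominator vanishes. *)
Theorem theorem3p3 :
  forall (k : nat) (beta EF : R), (0 < beta)%R ->
    (forall z : C, bernstein (alpha_fermi 0 beta EF) z ->
                   bernstein (alpha_fermi k beta EF) z) /\
    exists Rk : C -> C -> C,
      analytic2_on (bernstein (alpha_fermi k beta EF)) Rk /\
      forall eta omega : R, (0 < eta)%R ->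
      forall E1 E2 : C,
        bernstein (alpha_fermi k beta EF) E1 ->
        bernstein (alpha_fermi k beta EF) E2 ->
        ~ In E1 (Zk k beta EF) -> ~ In E2 (Zk k beta EF) ->
        E1 - E2 + omega + Ci * eta <> 0 ->
        F beta eta omega EF E1 E2 =
          / (E1 - E2 + omega + Ci * eta) *
          (Csum (Zk k beta EF)
                (fun z => / beta * / ((E1 - z) * (E2 - z))) + Rk E1 E2).
Proof.
  intros k beta EF Hb; split; [intros z; now apply alpha_fermi_mono|].
  destruct inv_one_minus_exp_regular_part as [c Hc].
  assert (Hreg : forall z, bernstein (alpha_fermi k beta EF) z ->
                   analytic_at (fermi_regular k beta EF c) z)
    by (intros z Hz; now apply analytic_at_fermi_regular).
  exists (divided_difference (fermi_regular k beta EF c)).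
  split; [now apply analytic2_on_divided_difference|].
  intros eta omega _ E1 E2 U1 U2 H1 H2 HD; unfold F.
  destruct (Ceq_dec E1 E2) as [<-|Hn]; [|now apply F_off_diag_decomposition].
  assert (AD : analytic_at (fun z => z - E1 + omega + Ci * eta) E1).
  { repeat apply analytic_at_plus; try apply analytic_at_const.
    apply analytic_at_id. }
  destruct (analytic_at_neq_0 _ _ AD HD) as (d1 & Hd1 & HD1).
  destruct (list_isolated (Zk k beta EF) E1) as (d2 & Hd2 & Hiso).
  (* On the diagonal the second argument stays at [E1] and the right-hand side is analytic in the
     first. The radius [d1] keeps the frequency denominator nonzero, and [d2] keeps [z] off [Zk], so
     the off-diagonal identity holds on the punctured disc. *)
  apply (iota_punctured_analytic _
    (fun z => / (z - E1 + omega + Ci * eta) *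
       (Csum (Zk k beta EF) (fun p => / beta * / ((z - p) * (E1 - p))) +
        divided_difference (fermi_regular k beta EF c) z E1)) E1 (Rmin d1 d2)).
  - apply analytic_at_mult; [now apply analytic_at_inv|].
    apply analytic_at_plus; [|now apply analytic_at_divided_difference_l, Hreg].
    apply analytic_at_Csum; intros p Hp.
    assert (E1 <> p) by now intros ->.
    apply analytic_at_mult; [apply analytic_at_const|].
    apply analytic_at_inv; [|now apply Cmult_neq_0; apply Cminus_eq_contra].
    apply analytic_at_mult; [|apply analytic_at_const].
    apply analytic_at_minus; [apply analytic_at_id|apply analytic_at_const].
  - now apply Rmin_pos.
  - intros z Hz Hzn.
    assert (Hz1 := Rlt_le_trans _ _ _ Hz (Rmin_l _ _)).
    assert (Hz2 := Rlt_le_trans _ _ _ Hz (Rmin_r _ _)).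
    apply F_off_diag_decomposition; trivial; [|now apply HD1].
    intros K; now apply Hzn, Hiso.
Qed.
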